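(* Let $T$ be a finite connected tree with adjacency matrix $A(T)$ and diagonal degree matrix $D(T)$, and let $O_1,\dots,O_m$ be the vertex orbits of $\operatorname{Aut}(T)$. Let $S=(\mathbf 1_{O_1},\dots,\mathbf 1_{O_m})$ and let $B_T,\Delta_T\in M_m(\mathbb R)$ be the unique matrices with $A(T)S=SB_T$ and $D(T)S=S\Delta_T$. Let $Q_T=\langle I_m,B_T,\Delta_T\rangle\subseteq M_m(\mathbb R)$. Then $$Q_T=M_m(\mathbb R).$$ Equivalently, $\langle A(T),D(T)\rangle|_{U_T}=\operatorname{End}(U_T)$.
   Context: $S$ is the $|V(T)|\times m$ matrix whose columns are the indicator vectors of the orbits. The orbit partition is equitable and degrees are constant on orbits, so $B_T$ and $\Delta_T$ exist and are unique, and $\Delta_T$ is diagonal. $\langle\cdots\rangle$ denotes the real unital matrix algebra generated by the listed matrices. $U_T=\operatorname{span}\{\mathbf 1_{O_1},\dots,\mathbf 1_{O_m}\}\subseteq\mathbb R^{V(T)}$ is the automorphism-orbit module, which is invariant under $A(T)$ and $D(T)$; $\langle A(T),D(T)\rangle|_{U_T}$ is the algebra of restrictions to $U_T$ of elements of $\langle I, A(T),D(T)\rangle$. *)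

(* Defs.v *)
From HB Require Import structures.
From mathcomp Require Import all_boot all_order all_algebra all_fingroup.
From mathcomp Require Import falgebra reals.

Set Implicit Arguments.
Unset Strict Implicit.
Unset Printing Implicit Defensive.

Import GRing.Theory.
Local Open Scope ring_scope.

(* Cycles of length at most 2 are excluded from the acyclicity condition: for a
   symmetric e, [ucycle e [:: x; y]] holds as soon as x and y are adjacent. *)
Definition is_tree (V : finType) (e : rel V) : Prop :=
  [/\ (0 < #|V|)%N, symmetric e, irreflexive e,
      (forall x y : V, connect e x y)
    & (forall c : seq V, ucycle e c -> (size c <= 2)%N)].

Definition graph_aut (V : finType) (e : rel V) : {set {perm V}} :=
  [set s : {perm V} | [forall x, forall y, e (s x) (s y) == e x y]].

Lemma graph_autP (V : finType) (e : rel V) (s : {perm V}) :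
  reflect (forall x y, e (s x) (s y) = e x y) (s \in graph_aut e).
Proof.
rewrite inE; apply: (iffP forallP) => h x.
  by move=> y; have /forallP/(_ y)/eqP := h x.
by apply/forallP=> y; rewrite h.
Qed.

Lemma graph_aut_group_set (V : finType) (e : rel V) : group_set (graph_aut e).
Proof.
apply/group_setP; split; first by apply/graph_autP=> x y; rewrite !perm1.
move=> s t /graph_autP hs /graph_autP ht; apply/graph_autP=> x y.
by rewrite !permM ht hs.
Qed.

Canonical graph_aut_group (V : finType) (e : rel V) :=
  Group (graph_aut_group_set e).

Definition vertex_orbits (V : finType) (e : rel V) : {set {set V}} :=
  orbit 'P (graph_aut e) @: [set: V].

(* O_0, ..., O_(m-1) lists the orbits without repetition, in any order. *)
Definition orbit_listing (V : finType) (e : rel V) (m : nat)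
    (O : 'I_m -> {set V}) : Prop :=
  injective O /\ [set O j | j : 'I_m] = vertex_orbits e.

(* Matrices over V are indexed by 'I_#|V| through enum_val. *)
Definition adj_mx (R : realType) (V : finType) (e : rel V) : 'M[R]_#|V| :=
  \matrix_(i, j) (e (enum_val i) (enum_val j))%:R.

Definition degree (V : finType) (e : rel V) (x : V) : nat :=
  #|[set y | e x y]|.

Definition deg_mx (R : realType) (V : finType) (e : rel V) : 'M[R]_#|V| :=
  diag_mx (\row_i (degree e (enum_val i))%:R).

Definition indicator (R : realType) (V : finType) (X : {set V}) :
    'cV[R]_#|V| :=
  \col_i (enum_val i \in X)%:R.

Definition orbit_mx (R : realType) (V : finType) (m : nat)
    (O : 'I_m -> {set V}) : 'M[R]_(#|V|, m) :=
  \matrix_(i, j) indicator R (O j) i ord0.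

(* The unital subalgebra generated by s.  [agenv] is only available for matrices
   of size n.+1, where it agrees with this definition (gen_alg_agenv). *)
Inductive gen_alg (R : realType) (n : nat) (s : seq 'M[R]_n) :
    'M[R]_n -> Prop :=
| gen_alg_in X : X \in s -> gen_alg s X
| gen_alg_1 : gen_alg s 1%:M
| gen_alg_scale a X : gen_alg s X -> gen_alg s (a *: X)
| gen_alg_add X Y : gen_alg s X -> gen_alg s Y -> gen_alg s (X + Y)
| gen_alg_mul X Y : gen_alg s X -> gen_alg s Y -> gen_alg s (X *m Y).

Definition orbit_module (R : realType) (V : finType) (m : nat)
    (O : 'I_m -> {set V}) : {vspace 'cV[R]_#|V|} :=
  <<[seq indicator R (O j) | j : 'I_m]>>%VS.

(* f is the restriction to U of some element of the algebra generated by s,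
   matrices acting on column vectors. *)
Definition restricted_alg (R : realType) (n : nat) (s : seq 'M[R]_n)
    (U : {vspace 'cV[R]_n}) (f : 'End(subvs_of U)) : Prop :=
  exists2 M : 'M[R]_n,
    gen_alg s M & forall u : subvs_of U, vsval (f u) = M *m vsval u.

Lemma gen_alg_sum (R : realType) n (s : seq 'M[R]_n) I (r : seq I) F :
  (forall i, gen_alg s (F i)) -> gen_alg s (\sum_(i <- r) F i).
Proof.
move=> h; elim/big_rec: _ => [|i X _ hX]; last exact: gen_alg_add.
by rewrite -(scale0r 1%:M); apply/gen_alg_scale/gen_alg_1.
Qed.

Lemma gen_alg_span (R : realType) n (s : seq 'M[R]_n) (t : seq 'M[R]_n) :
  (forall X, X \in t -> gen_alg s X) ->
  forall X, X \in <<t>>%VS -> gen_alg s X.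
Proof.
move=> h X hX; rewrite (coord_span (X := in_tuple t) hX).
by apply: gen_alg_sum => i; apply/gen_alg_scale/h; rewrite mem_nth.
Qed.

Lemma gen_alg_agenv (R : realType) n (s : seq 'M[R]_n.+1) X :
  gen_alg s X <-> X \in agenv <<s>>%VS.
Proof.
split.
  elim=> {X} [X hX||a X _ hX|X Y _ hX _ hY|X Y _ hX _ hY].
  - exact/(subvP (sub_agenv _))/memv_span.
  - by have /subvP := sub1_agenv <<s>>%VS; apply; apply: memv_line.
  - exact: rpredZ.
  - exact: rpredD.
  - by rewrite -[agenv _]agenvM; apply: memv_mul.
case/memv_sumP=> F hF ->; apply: gen_alg_sum => i; move: (hF i isT).
move: (F i) (i : nat) => Y k; elim: k Y => [|k IHk] Y.
  rewrite expv0 => /vlineP[a ->]; exact/gen_alg_scale/gen_alg_1.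
rewrite expvSl [@prodv _ _]unlock => hY; apply: gen_alg_span hY => Z.
case/allpairsP=> -[A B] [/= /vbasis_mem hA /vbasis_mem hB ->].
apply: gen_alg_mul; last exact: IHk.
exact: gen_alg_span (@gen_alg_in _ _ s) _ hA.
Qed.

Section Quotient.
Variables (R : realType) (V : finType) (e : rel V) (m : nat).
Variables (O : 'I_m -> {set V}) (hO : orbit_listing e O).

Local Notation S := (orbit_mx R O).

Lemma orbit_listing_cover x : exists j, O j = orbit 'P (graph_aut e) x.
Proof.
have: orbit 'P (graph_aut e) x \in vertex_orbits e by apply: imset_f.
by case: hO => _ <- /imsetP[j _ ->]; exists j.
Qed.

Lemma orbit_listingE j x : x \in O j -> O j = orbit 'P (graph_aut e) x.
Proof.
have: O j \in vertex_orbits e by case: hO => _ <-; apply: imset_f.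
by case/imsetP=> y _ -> /orbit_in_eqP->; rewrite ?subsetT.
Qed.

Lemma orbit_mx_inj p (X Y : 'M[R]_(m, p)) : S *m X = S *m Y -> X = Y.
Proof.
move=> eqXY; apply/matrixP=> j k.
have [x xj] : exists x, x \in O j.
  have: O j \in vertex_orbits e by case: hO => _ <-; apply: imset_f.
  by case/imsetP=> x _ ->; exists x; apply: orbit_refl.
suff row_S (Z : 'M[R]_(m, p)) : (S *m Z) (enum_rank x) k = Z j k.
  by rewrite -!row_S eqXY.
rewrite mxE (bigD1 j) //= big1 => [|i ij]; rewrite !mxE enum_rankK.
  by rewrite xj mul1r addr0.
case: (boolP (x \in O i)) => xi; last by rewrite mul0r.
case: hO => O_inj _; case/eqP: ij; apply: O_inj.
by rewrite (orbit_listingE xi) (orbit_listingE xj).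
Qed.

Lemma quotient_mx_exists (M : 'M[R]_#|V|) :
  (forall s x y, s \in graph_aut e ->
     M (enum_rank (s x)) (enum_rank (s y)) = M (enum_rank x) (enum_rank y)) ->
  exists! B : 'M[R]_m, M *m S = S *m B.
Proof.
move=> hM; suff [B hB] : exists B : 'M[R]_m, M *m S = S *m B.
  by exists B; split=> // B'; rewrite hB => /orbit_mx_inj.
pose c (x : V) (k : 'I_m) := \sum_(y in O k) M (enum_rank x) (enum_rank y).
have MSE i k : (M *m S) i k = c (enum_val i) k.
  rewrite mxE (reindex enum_rank) /=; last first.
    by exists enum_val => ? _; rewrite (enum_rankK, enum_valK).
  rewrite /c [RHS]big_mkcond; apply: eq_bigr => y _; rewrite !mxE enum_rankK enum_valK.
  by case: ifP; rewrite (mulr1, mulr0).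
have c_orb x y k : y \in orbit 'P (graph_aut e) x -> c y k = c x k.
  case/orbitP=> s hs <-; rewrite /c /= (reindex_inj (@perm_inj _ s)) /=.
  apply: eq_big => [z|z _]; last by rewrite apermE hM.
  apply/idP/idP => hz; rewrite (orbit_listingE hz).
    by apply/orbitP; exists (s^-1)%g; rewrite ?groupV //= apermE permK.
  by apply/orbitP; exists s.
have O_x j : {x | x \in O j}.
  apply/sigW; have: O j \in vertex_orbits e by case: hO => _ <-; apply: imset_f.
  by case/imsetP=> x _ ->; exists x; apply: orbit_refl.
exists (\matrix_(j, k) c (sval (O_x j)) k); apply/matrixP=> i k.
rewrite MSE mxE; have [j Oj] := orbit_listing_cover (enum_val i).
have ij : enum_val i \in O j by rewrite Oj orbit_refl.
rewrite (bigD1 j) //= big1 ?addr0 => [|l lj]; rewrite !mxE.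
  rewrite ij mul1r; case: (O_x j) => x /= xj.
  by apply: c_orb; rewrite -(orbit_listingE xj).
case: (boolP (enum_val i \in O l)) => il; last by rewrite mul0r.
by case: hO => O_inj _; case/eqP: lj; apply: O_inj; rewrite Oj (orbit_listingE il).
Qed.

Lemma adj_quotient_exists :
  exists! B : 'M[R]_m, adj_mx R e *m S = S *m B.
Proof.
apply: quotient_mx_exists => s x y /graph_autP hs.
by rewrite !mxE !enum_rankK hs.
Qed.

Lemma deg_quotient_exists :
  exists! Delta : 'M[R]_m, deg_mx R e *m S = S *m Delta.
Proof.
apply: quotient_mx_exists => s x y /graph_autP hs.
rewrite !mxE !enum_rankK !(inj_eq enum_rank_inj) (inj_eq perm_inj).
congr (_%:R *+ _); rewrite /degree -[RHS](card_imset _ (@perm_inj _ s)).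
apply: eq_card => z; rewrite inE; apply/idP/imsetP => [hz|[w + ->]].
  by exists ((s^-1)%g z); rewrite ?permKV // inE -hs permKV.
by rewrite inE hs.
Qed.

Lemma orbit_moduleP (v : 'cV[R]_#|V|) :
  v \in orbit_module R O <-> exists w : 'cV[R]_m, v = S *m w.
Proof.
have SE (w : 'cV[R]_m) : S *m w = \sum_j w j ord0 *: indicator R (O j).
  apply/colP=> i; rewrite mxE summxE; apply: eq_bigr => j _.
  by rewrite !mxE mulrC.
split=> [hv|[w ->]].
  have : v \in (\sum_j <[indicator R (O j)]>)%VS.
    by move: hv; rewrite /orbit_module span_def big_map big_enum.
  case/memv_sumP=> F hF ->.
  have /fin_all_exists[w hw] j : exists a, F j = a *: indicator R (O j).
    by apply/vlineP/hF.
  exists (\col_j w j); rewrite SE; apply: eq_bigr => j _; by rewrite mxE hw.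
rewrite SE; apply: rpred_sum => j _; apply/rpredZ/memv_span/map_f.
by rewrite mem_enum.
Qed.

Lemma gen_alg_restricts (M : 'M[R]_#|V|) :
  gen_alg [:: 1%:M; adj_mx R e; deg_mx R e] M ->
  exists f : 'End(subvs_of (orbit_module R O)),
    forall u, vsval (f u) = M *m vsval u.
Proof.
move=> hM; have [B hB] : exists B : 'M[R]_m, M *m S = S *m B.
  elim: hM => [X||a X _ [B hB]|X Y _ [B hB] _ [C hC]|X Y _ [B hB] _ [C hC]].
  - rewrite !inE => /or3P[] /eqP->.
    + by exists 1%:M; rewrite mul1mx mulmx1.
    + by have [B []] := adj_quotient_exists; exists B.
    + by have [B []] := deg_quotient_exists; exists B.
  - by exists 1%:M; rewrite mul1mx mulmx1.
  - by exists (a *: B); rewrite -scalemxAl hB scalemxAr.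
  - by exists (B + C); rewrite mulmxDl mulmxDr hB hC.
  - by exists (B *m C); rewrite -mulmxA hC mulmxA hB mulmxA.
pose g := (linfun (vsproj (orbit_module R O)) \o
           (linfun (mulmx M) \o linfun (vsval (U := orbit_module R O))))%VF.
exists g => u; rewrite !comp_lfunE !lfunE /= vsprojK //.
have /orbit_moduleP[w ->] := subvsP u.
by apply/orbit_moduleP; exists (B *m w); rewrite !mulmxA hB.
Qed.

End Quotient.

(* Main.v *)
Require Import Defs.
From mathcomp Require Import all_boot all_order all_algebra all_fingroup.
From mathcomp Require Import reals boolp.

(** Work in the algebra K generated by A(T) and D(T), its members being read as
    kernels V -> V -> R; K is closed under transposition because its generators
    are symmetric.  It suffices to find in K every kernel 1_X (x) 1_Y with X and Y
    orbits of Aut(T): on the orbit module these are, up to scalars, the matrix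
    units ([orbit_kernel], [quotient_realization]).

    K sees the peeling of the leaves.  Let W_0 = V and let W_{k+1} consist of the
    vertices with at least two neighbours in W_k.  If the indicator of W_k and the
    degrees inside W_k are diagonal elements of K, then so are those of W_{k+1}:
    levels of a diagonal element are polynomials in it, and if L is the set of
    vertices of W_k with exactly one neighbour in W_k, then A 1_L A, cut down to W_k,
    is diagonal and counts the neighbours in L, which are the degrees lost in passing
    to W_{k+1} ([peel_definable]).  The peeling of a tree ends with the empty set.
    Let rank x be the last k with x in W_k.  Then x has at most one neighbour of
    rank at least its own, its parent; every edge joins a vertex to its parent, and
    iterating parent leads from every vertex to the centre of the tree, which is a
    fixed vertex or a pair of vertices swapped by parent ([max_rank_root]).  The
    matrix P with P(x, y) = 1 if parent x = y, and 0 otherwise, is in K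
    ([parent_definable]).

    From here on, only P and the projector on the centre are used.  Call x and y similar if no diagonal element of K
    separates them, and path-similar if their iterated parents are similar step by
    step.  Since P^T diag(h) P is the diagonal matrix of the sums of h over the
    children, similar vertices have equally many children in each similarity
    class.  Hence a partial isomorphism defined on a parent-closed set of vertices
    and preserving path-similarity can be extended one vertex at a time, and
    path-similar vertices are conjugate under Aut(T) ([similar_conjugate]).
    Conversely every element of K is Aut(T)-invariant, so that the path-similarity
    classes are exactly the orbits.  Finally, if C is the class of a central vertex
    then 1_X (x) 1_C is obtained by descending from the centre, one application of
    P and one similarity projector at each step ([class_root_kernel]), and
    1_X (x) 1_Y is, up to the factor |C|, the product of 1_X (x) 1_C with the
    transpose of 1_Y (x) 1_C ([class_kernel]). *)

Set Implicit Arguments.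
Unset Strict Implicit.
Unset Printing Implicit Defensive.

Import Order.TTheory GRing.Theory Num.Theory.
Local Open Scope ring_scope.

(** * Algebras of kernels closed under transposition *)

Section StarAlgebra.
Variables (R : numFieldType) (V : finType).
Implicit Types (F G : V -> V -> R) (h : V -> R).

Definition kdiag h : V -> V -> R := fun x y => h x *+ (x == y).
Definition kmul F G : V -> V -> R := fun x y => \sum_z F x z * G z y.

Record star_algebra (K : (V -> V -> R) -> Prop) : Prop := StarAlgebra {
  star_one : K (kdiag (fun=> 1));
  star_scale : forall a F, K F -> K (fun x y => a * F x y);
  star_add : forall F G, K F -> K G -> K (fun x y => F x y + G x y);
  star_mul : forall F G, K F -> K G -> K (kmul F G);
  star_tr : forall F, K F -> K (fun x y => F y x) }.

Lemma kmul_diagl h F : kmul (kdiag h) F = fun x y => h x * F x y.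
Proof.
apply/funext=> x; apply/funext=> y; rewrite /kmul (bigD1 x) //= /kdiag eqxx.
by rewrite big1 ?addr0 // => z /negbTE zx; rewrite eq_sym zx mul0r.
Qed.

Lemma kmul_diagr h F : kmul F (kdiag h) = fun x y => F x y * h y.
Proof.
apply/funext=> x; apply/funext=> y; rewrite /kmul (bigD1 y) //= /kdiag eqxx.
by rewrite big1 ?addr0 // => z /negbTE zy; rewrite zy mulr0.
Qed.

Variables (K : (V -> V -> R) -> Prop) (KS : star_algebra K).

Lemma star_ext F G : F =2 G -> K F -> K G.
Proof. by move=> FG; rewrite (_ : F = G) //; apply/funext=> x; apply/funext=> y. Qed.

Definition diagonal h : Prop := K (kdiag h).

Lemma diagonal_ext h h' : h =1 h' -> diagonal h -> diagonal h'.
Proof. by move=> /funext ->. Qed.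

Lemma diagonal_cst c : diagonal (fun=> c).
Proof.
apply: star_ext (star_scale KS c (star_one KS)) => x y.
by rewrite /kdiag mulrnAr mulr1.
Qed.

Lemma diagonalD h h' : diagonal h -> diagonal h' -> diagonal (fun x => h x + h' x).
Proof.
move=> hh hh'; apply: star_ext (star_add KS hh hh') => x y.
by rewrite /kdiag mulrnDl.
Qed.

Lemma star_mull h F : diagonal h -> K F -> K (fun x y => h x * F x y).
Proof. by move=> hh hF; rewrite -kmul_diagl; apply: star_mul. Qed.

Lemma star_mulr h F : diagonal h -> K F -> K (fun x y => F x y * h y).
Proof. by move=> hh hF; rewrite -kmul_diagr; apply: star_mul. Qed.

Lemma diagonalM h h' : diagonal h -> diagonal h' -> diagonal (fun x => h x * h' x).
Proof.
move=> hh hh'; apply: star_ext (star_mull hh hh') => x y.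
by rewrite /kdiag mulrnAr.
Qed.

Lemma diagonalB h h' : diagonal h -> diagonal h' -> diagonal (fun x => h x - h' x).
Proof.
move=> hh hh'.
apply: (diagonal_ext _ (diagonalD hh (diagonalM (diagonal_cst (- 1)) hh'))) => x.
by rewrite mulN1r.
Qed.

Lemma diagonal_sum (I : Type) (s : seq I) (P : pred I) (h : I -> V -> R) :
  (forall i, P i -> diagonal (h i)) -> diagonal (fun x => \sum_(i <- s | P i) h i x).
Proof.
move=> hh; elim: s => [|i s IH].
  by apply: diagonal_ext (diagonal_cst 0) => x; rewrite big_nil.
case: (boolP (P i)) => Pi; last first.
  by apply: diagonal_ext IH => x; rewrite big_cons (negbTE Pi).
by apply: diagonal_ext (diagonalD (hh i Pi) IH) => x; rewrite big_cons Pi.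
Qed.

Lemma diagonal_prod (I : Type) (s : seq I) (P : pred I) (h : I -> V -> R) :
  (forall i, P i -> diagonal (h i)) -> diagonal (fun x => \prod_(i <- s | P i) h i x).
Proof.
move=> hh; elim: s => [|i s IH].
  by apply: diagonal_ext (diagonal_cst 1) => x; rewrite big_nil.
case: (boolP (P i)) => Pi; last first.
  by apply: diagonal_ext IH => x; rewrite big_cons (negbTE Pi).
by apply: diagonal_ext (diagonalM (hh i Pi) IH) => x; rewrite big_cons Pi.
Qed.

Lemma star_sum (I : Type) (s : seq I) (F : I -> V -> V -> R) :
  (forall i, K (F i)) -> K (fun x y => \sum_(i <- s) F i x y).
Proof.
move=> hF; elim: s => [|i s IH].
  by apply: star_ext (diagonal_cst 0) => x y; rewrite big_nil /kdiag mul0rn.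
by apply: star_ext (star_add KS (hF i) IH) => x y; rewrite big_cons.
Qed.

(** Lagrange interpolation: the level sets of a diagonal element are cut out by
    polynomials in it, the other values of the element being the nodes. *)
Lemma diagonal_level h c : diagonal h -> diagonal (fun x => (h x == c)%:R).
Proof.
move=> hh.
have /diagonal_ext : (fun x => \prod_(y | h y != c) ((h x - h y) * (c - h y)^-1))
    =1 (fun x => (h x == c)%:R).
  move=> x; case: eqVneq => [->|hx].
    by rewrite big1 // => y hy; rewrite divff // subr_eq0 eq_sym.
  by rewrite (bigD1 x) //= subrr !mul0r.
apply; apply: diagonal_prod => y _.
apply: diagonalM (diagonal_cst _); exact: diagonalB (diagonal_cst _).
Qed.

(** The classes of [sim] are the atoms of the algebra of diagonal elements. *)
Definition sim : rel V := fun x y => `[< forall h, diagonal h -> h x = h y >].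

Lemma simP x y : reflect (forall h, diagonal h -> h x = h y) (sim x y).
Proof. exact: asboolP. Qed.

Lemma sim_refl : reflexive sim. Proof. by move=> x; apply/simP. Qed.

Lemma sim_sym : symmetric sim.
Proof. by move=> x y; apply/simP/simP=> xy h /xy. Qed.

Lemma sim_trans : transitive sim.
Proof. by move=> y x z /simP xy /simP yz; apply/simP=> h hh; rewrite xy // yz. Qed.

(** Each vertex z outside the class of x is excluded by a level set of some
    diagonal element; the product of these finitely many level sets is the class. *)
Lemma diagonal_sim x : diagonal (fun y => (sim y x)%:R).
Proof.
have sep z : exists h, diagonal h /\ (~~ sim z x -> h z != h x).
  case: (boolP (sim z x)) => [_|/asboolPn/existsNP[h /not_implyP[hh /eqP zx]]].
    by exists (fun=> 0); split=> //; apply: diagonal_cst.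
  by exists h.
have [h hP] := fin_all_exists sep.
have /diagonal_ext : (fun y => \prod_(z | ~~ sim z x) (h z y == h z x)%:R)
    =1 (fun y => (sim y x)%:R : R).
  move=> y; case: (boolP (sim y x)) => yx; last first.
    by rewrite (bigD1 y) //= (negbTE ((hP y).2 yx)) mul0r.
  by rewrite big1 // => z _; rewrite (simP _ _ yx _ (hP z).1) eqxx.
apply; apply: diagonal_prod => z _; apply: diagonal_level; exact: (hP z).1.
Qed.

(** * Matrix units from a parent map *)

Section FunctionalGraph.
Variables (par : V -> V) (r : V).
Hypothesis K_par : K (fun x y => (par x == y)%:R).
Hypothesis par_root : par (par r) = r.
Hypothesis par_reach : forall x, exists i, iter i par x = r.
Hypothesis K_root : diagonal (fun x => (x \in [set r; par r])%:R).

(** If P is the matrix of [par] then P^T diag(h) P is diagonal, because a vertex has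
    only one parent. *)
Lemma diagonal_push h : diagonal h -> diagonal (fun x => \sum_(z | par z == x) h z).
Proof.
move=> hh; apply: star_ext (star_mul KS (star_tr KS K_par) (star_mull hh K_par)) => x y.
rewrite /kmul /kdiag -sumrMnl [RHS]big_mkcond /=; apply: eq_bigr => z _.
case: (eqVneq (par z) x) => [->|_]; last by rewrite mul0r.
by rewrite mul1r mulr_natr.
Qed.

(** The similarity types met on the way from x to the root; this turns out to be a
    complete invariant of the position of x up to automorphism. *)
Definition path_sim : rel V :=
  fun x y => `[< forall i, sim (iter i par x) (iter i par y) >].

Lemma path_simP x y :
  reflect (forall i, sim (iter i par x) (iter i par y)) (path_sim x y).
Proof. exact: asboolP. Qed.

Lemma path_sim_equiv : equivalence_rel path_sim.
Proof.
have refl x : path_sim x x by apply/path_simP=> i; apply: sim_refl.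
have sym x y : path_sim x y -> path_sim y x.
  by move=> /path_simP xy; apply/path_simP=> i; rewrite sim_sym.
have trans x y z : path_sim x y -> path_sim y z -> path_sim x z.
  move=> /path_simP xy /path_simP yz; apply/path_simP=> i.
  exact: sim_trans (xy i) (yz i).
move=> x y z; split=> // xy; apply/idP/idP; last exact: trans.
by apply: trans; apply: sym.
Qed.

Lemma path_simE x y : path_sim x y = sim x y && path_sim (par x) (par y).
Proof.
apply/path_simP/andP => [xy|[xy /path_simP pxy] [|i]//].
  split; first exact: (xy 0).
  by apply/path_simP=> i; rewrite -!iterSr; apply: xy.
by rewrite !iterSr; apply: pxy.
Qed.

(** A child of x is path-similar to z exactly when it is similar to z and x is
    path-similar to [par z]; so the count is a value of a diagonal element at x. *)
Lemma path_sim_children x y z : path_sim x y ->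
  #|[set u | (par u == x) && path_sim u z]| = #|[set u | (par u == y) && path_sim u z]|.
Proof.
move=> xy; have trl := path_sim_equiv.
have childE w : path_sim w (par z) ->
  [set u | (par u == w) && path_sim u z] = [set u | (par u == w) && sim u z].
  move=> wz; apply/setP=> u; rewrite !inE; case: eqVneq => //= uw.
  by rewrite path_simE uw wz andbT.
have [xz|xz] := boolP (path_sim x (par z)).
  have yz : path_sim y (par z) by rewrite -((trl _ _ _).2 xy).
  rewrite !childE //; apply/eqP; rewrite -(eqr_nat R); apply/eqP.
  have cardE w : (#|[set u | (par u == w) && sim u z]|)%:R
      = \sum_(u | par u == w) (sim u z)%:R :> R.
    rewrite -sum1_card natr_sum [LHS]big_mkcond [RHS]big_mkcond /=.
    by apply: eq_bigr => u _; rewrite inE; case: eqP => //=; case: ifP.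
  rewrite !cardE; move: xy; rewrite path_simE => /andP[/simP xy _].
  exact: xy _ (diagonal_push (diagonal_sim z)).
have yz : ~~ path_sim y (par z) by rewrite -((trl _ _ _).2 xy).
suff E w : ~~ path_sim w (par z) -> [set u | (par u == w) && path_sim u z] = set0.
  by rewrite !E.
move=> wz; apply/setP=> u; rewrite !inE; case: eqVneq => //= uw.
by rewrite path_simE uw (negbTE wz) andbF.
Qed.

Lemma path_sim_root x y : path_sim x y -> x \in [set r; par r] -> y \in [set r; par r].
Proof.
rewrite path_simE => /andP[/simP/(_ _ K_root) + _] => /eqP; rewrite eqr_nat => /eqP.
by do 2!case: (_ \in _).
Qed.

(** On the pair {r, par r}, which [par] swaps or fixes, similarity to r suffices:
    the iterates of the two vertices only alternate between them. *)
Lemma path_sim_rootE x : path_sim x r = sim x r && (x \in [set r; par r]).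
Proof.
apply/idP/andP => [xr|[xr]].
  split; first by move: xr; rewrite path_simE => /andP[].
  apply: (@path_sim_root r); last by rewrite !inE eqxx.
  by rewrite -((path_sim_equiv x r x).2 xr) (path_sim_equiv x x x).1.
rewrite !inE => /orP[]/eqP ex; first by subst x; have [] := path_sim_equiv r r r.
subst x; apply/path_simP=> i.
suff [H|H] : (iter i par (par r) = par r /\ iter i par r = r) \/
             (iter i par (par r) = r /\ iter i par r = par r).
- by case: H => -> ->.
- by case: H => -> ->; rewrite sim_sym.
elim: i => [|i IH] /=; first by left.
by case: IH => -[-> ->]; rewrite par_root; [right|left].
Qed.

(** The all-ones kernel on the pair {r, par r} is the projector on it, times 1 + P
    if the two vertices differ. *)
Lemma root_kernel : K (fun x y => (path_sim x r)%:R * (path_sim y r)%:R).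
Proof.
have K_RR : K (fun x y => (x \in [set r; par r])%:R * (y \in [set r; par r])%:R).
  case: (eqVneq (par r) r) => [pr|pr].
    apply: star_ext K_root => x y; rewrite /kdiag !inE pr !orbb.
    case: (eqVneq x r) => [->|]; last by rewrite mul0rn mul0r.
    by rewrite mul1r eq_sym.
  apply: star_ext (star_mull K_root (star_add KS (star_one KS) K_par)) => x y.
  rewrite /kdiag !inE; case: (eqVneq x r) => [->|xr] /=.
    rewrite !mul1r ![y == _]eq_sym; case: (eqVneq r y) => [<-|_] /=.
      by rewrite (negbTE pr) addr0.
    by rewrite add0r.
  case: (eqVneq x (par r)) => [->|]; last by rewrite !mul0r.
  rewrite par_root !mul1r ![y == _]eq_sym; case: (eqVneq r y) => [<-|_] /=.
    by rewrite (negbTE pr) add0r.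
  by rewrite addr0.
apply: star_ext (star_mull (diagonal_sim r) (star_mulr (diagonal_sim r) K_RR)) => x y.
rewrite !path_sim_rootE -!natrM !mulnb.
by case: (sim x r); case: (sim y r); case: (x \in _); case: (y \in _).
Qed.

(** Induction on the distance to r: applying P to the class of [par x] gives all the
    children of that class, among which the similarity class of x cuts out the
    path-similarity class of x. *)
Lemma class_root_kernel x : K (fun u v => (path_sim u x)%:R * (path_sim v r)%:R).
Proof.
have [i] := par_reach x; elim: i x => [|i IH] x; first by move=> /= ->; exact: root_kernel.
rewrite iterSr => /IH Kpx.
apply: star_ext (star_mull (diagonal_sim x) (star_mul KS K_par Kpx)) => u v.
rewrite /kmul (bigD1 (par u)) //= eqxx mul1r big1 ?addr0 => [|z zu].
  by rewrite mulrA -natrM mulnb -path_simE.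
by rewrite eq_sym (negbTE zu) mul0r.
Qed.

Lemma class_kernel x y : K (fun u v => (path_sim u x)%:R * (path_sim v y)%:R).
Proof.
pose c : R := \sum_z (path_sim z r)%:R.
have c0 : c != 0.
  rewrite /c -natr_sum pnatr_eq0 sum_nat_eq0; apply/forallPn; exists r.
  by have [-> _] := path_sim_equiv r r r.
have Kxy := star_mul KS (class_root_kernel x) (star_tr KS (class_root_kernel y)).
apply: star_ext (star_scale KS c^-1 Kxy) => u v.
have -> : kmul (fun u v => (path_sim u x)%:R * (path_sim v r)%:R)
    (fun u v => (path_sim v y)%:R * (path_sim u r)%:R) u v
    = (path_sim u x)%:R * (path_sim v y)%:R * c.
  rewrite /kmul /c mulr_sumr; apply: eq_bigr => z _.
  by case: (path_sim z r); rewrite ?(mulr0, mulr1).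
by rewrite mulrC mulfK.
Qed.

End FunctionalGraph.
End StarAlgebra.

(** * Extension of partial isomorphisms *)

Section Extension.
Variables (V : finType) (par : V -> V) (r : V) (sm : rel V).
Hypothesis par_root : par (par r) = r.
Hypothesis par_reach : forall x, exists i, iter i par x = r.
Hypothesis sm_equiv : equivalence_rel sm.
Hypothesis sm_par : forall x y, sm x y -> sm (par x) (par y).
Hypothesis sm_root : forall x y, sm x y -> x \in [set r; par r] -> y \in [set r; par r].
Hypothesis sm_children : forall x y z, sm x y ->
  #|[set u | (par u == x) && sm u z]| = #|[set u | (par u == y) && sm u z]|.

(** Closure of D under [par] makes the image closed under [par] as well, so that a
    child outside D can be sent to any free child of the image of its parent. *)
Definition partial_iso (D : {set V}) (f : V -> V) : Prop :=
  [/\ {in D, forall z, par z \in D}, {in D &, injective f},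
      {in D, forall z, f (par z) = par (f z)} & {in D, forall z, sm (f z) z}].

Lemma partial_iso_extend D f z w : partial_iso D f -> z \notin D -> par z \in D ->
  w \notin f @: D -> par w = f (par z) -> sm w z ->
  partial_iso (z |: D) (fun u => if u == z then w else f u).
Proof.
move=> [Dpar finj fpar fsm] zD pzD wD pw wz.
have neq u : u \in D -> (u == z) = false.
  by move=> uD; apply/eqP=> uz; rewrite -uz uD in zD.
have fw u : u \in D -> w <> f u by move=> uD wu; rewrite wu imset_f in wD.
split.
- by move=> u; rewrite !inE => /orP[/eqP->|/Dpar ->]; rewrite ?pzD orbT.
- move=> u v; rewrite !inE => /orP[/eqP->|uD] /orP[/eqP->|vD] //=; rewrite ?eqxx ?neq //.
  + by move/fw => [].
  + by move=> /esym/fw [].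
  + exact: finj.
- move=> u; rewrite !inE => /orP[/eqP->|uD]; first by rewrite eqxx neq.
  by rewrite !neq ?Dpar // fpar.
- by move=> u; rewrite !inE => /orP[/eqP->|uD]; rewrite ?eqxx ?neq ?fsm.
Qed.

(** A vertex on a cycle of [par] is an iterate of r, since it returns to itself after
    having passed through r. *)
Lemma cyclic_root x j : iter j.+1 par x = x -> x \in [set r; par r].
Proof.
move=> cyc; have [i ix] := par_reach x.
have root_par n : iter n par r \in [set r; par r].
  elim: n => [|n]; first by rewrite !inE eqxx.
  by rewrite iterS !inE => /orP[]/eqP->; rewrite ?par_root eqxx ?orbT.
have -> : x = iter (i * j.+1) par x.
  by elim: i {ix} => [//|k IH]; rewrite mulSn iterD -IH.
by rewrite mulnS addnC iterD ix.
Qed.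

Let sm_refl x : sm x x. Proof. exact: (sm_equiv x x x).1. Qed.

Let sm_sym x y : sm x y -> sm y x.
Proof. by move=> xy; rewrite -((sm_equiv x y x).2 xy). Qed.

(** The isomorphism is the identity or the swap [par]. *)
Lemma partial_iso_root x y : sm x y -> x \in [set r; par r] ->
  exists f, partial_iso [set r; par r] f /\ f x = y.
Proof.
move=> xy xR; have yR := sm_root xy xR.
have Rpar : {in [set r; par r], forall z, par z \in [set r; par r]}.
  by move=> z; rewrite !inE => /orP[]/eqP->; rewrite ?par_root eqxx ?orbT.
have [exy|nxy] := eqVneq x y; first by exists id; split=> //; split=> // z _.
have Rpp : {in [set r; par r], cancel par par}.
  by move=> z; rewrite !inE => /orP[]/eqP->; rewrite !par_root.
have RE z : z \in [set r; par r] -> par x = y /\ sm (par z) z.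
  by move: xR yR nxy xy; rewrite !inE => /orP[]/eqP-> /orP[]/eqP->;
     rewrite ?eqxx // => _ xy /orP[]/eqP->; rewrite ?par_root; split=> //; apply: sm_sym.
exists par; split; last exact: (RE x xR).1.
split=> // [u v uR vR uv|z /RE[]//].
by rewrite -(Rpp u) // uv Rpp.
Qed.

(** The isomorphism is built on the path from x to the root, from the root down.
    Keeping D inside the set of iterates of x guarantees that x and y are
    still free when their turn comes: otherwise they would lie on a cycle of
    [par]. *)
Lemma partial_iso_orbit x y : sm x y -> exists D f,
  [/\ partial_iso D f, x \in D, f x = y & {in D, forall z, exists j, iter j par x = z}].
Proof.
have [i] := par_reach x; elim: i x y => [|i IH] x y ix xy.
all: have [xR|xR] := boolP (x \in [set r; par r]).
all: try by have [f [isof fx]] := partial_iso_root xy xR;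
       exists [set r; par r], f; split=> // z; move: xR; rewrite !inE =>
       /orP[]/eqP-> /orP[]/eqP->; try (by exists 0); by exists 1; rewrite /= ?par_root.
  by move: xR; rewrite -ix /= !inE eqxx.
rewrite iterSr in ix.
have [D [f [isof pxD fpx Dx]]] := IH _ _ ix (sm_par xy).
have [Dpar finj fpar fsm] := isof.
have xD : x \notin D.
  by apply: contra xR => /Dx[j]; rewrite -iterSr; apply: cyclic_root.
have f_iter j : f (iter j par (par x)) = iter j par (par y) /\ iter j par (par x) \in D.
  by elim: j => [//|j [IHj jD]]; rewrite !iterS fpar // IHj; split=> //; apply: Dpar.
have yD : y \notin f @: D.
  apply: contra xR => /imsetP[z /[dup] zD /Dx[j <-]]; rewrite (f_iter j).1 -iterSr => jy.
  by apply: sm_root (cyclic_root (esym jy)); apply: sm_sym.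
exists (x |: D), (fun u => if u == x then y else f u); split.
- by apply: partial_iso_extend => //; apply: sm_sym.
- by rewrite !inE eqxx.
- by rewrite eqxx.
- move=> z; rewrite !inE => /orP[/eqP->|/Dx[j <-]]; first by exists 0.
  by exists j.+1; rewrite iterSr.
Qed.

(** A vertex z outside D with parent in D has a free image: [par z] and its image
    have equally many children path-similar to z, and the images in use among the
    latter come from children of [par z] in D, which z itself is not. *)
Lemma partial_iso_total D f : partial_iso D f -> r \in D ->
  exists2 g, partial_iso setT g & {in D, g =1 f}.
Proof.
have [n] := ubnP #|~: D|; elim: n D f => // n IH D f ltn isof rD.
have [DT|/subsetPn[u _ uD]] := boolP (setT \subset D).
  have {}DT : D = setT by apply/eqP; rewrite eqEsubset subsetT.
  by subst D; exists f.
have [z zD pzD] : exists2 z, z \notin D & par z \in D.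
  have [i iu] := par_reach u; elim: i u uD iu => [|i IHi] u uD iu.
    by rewrite -iu /= (negbTE uD) in rD.
  have [puD|puD] := boolP (par u \in D); first by exists u.
  by apply: (IHi (par u)); rewrite // -iterSr.
have [Dpar finj fpar fsm] := isof.
pose Ch p := [set u | (par u == p) && sm u z].
(* If all of Ch (f (par z)) were taken, D would contain all of Ch (par z). *)
have [w wCh wD] : exists2 w, w \in Ch (f (par z)) & w \notin f @: D.
  suff : ~~ (Ch (f (par z)) \subset f @: (D :&: Ch (par z))).
    case/subsetPn=> w wCh wD; exists w => //; apply: contra wD => /imsetP[v vD ev].
    apply/imsetP; exists v => //; move: wCh; rewrite {}ev !inE vD -fpar // => /andP[/eqP pv vz].
    rewrite (finj _ _ (Dpar _ vD) pzD pv) eqxx /=.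
    by rewrite ((sm_equiv v (f v) z).2 _) // sm_sym // fsm.
  apply/negP=> /subset_leq_card; apply/negP; rewrite -ltnNge.
  rewrite -(sm_children z (sm_sym (fsm _ pzD))).
  apply: leq_ltn_trans (leq_imset_card _ _) _; apply: proper_card.
  rewrite properE subsetIr /=; apply/subsetPn; exists z; rewrite !inE ?eqxx ?sm_refl //.
  by rewrite (negbTE zD).
move: wCh; rewrite inE => /andP[/eqP pw wz].
have [||g isog gf] := IH (z |: D) _ _ (partial_iso_extend isof zD pzD wD pw wz).
- rewrite -ltnS (leq_trans _ ltn) // ltnS; apply: proper_card.
  by rewrite properC properE subsetUr; apply/subsetPn; exists z; rewrite // !inE eqxx.
- by rewrite !inE rD orbT.
exists g => // v vD; rewrite gf ?inE ?vD ?orbT //.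
by case: eqP => // vz; rewrite -vz vD in zD.
Qed.

Lemma similar_conjugate x y : sm x y ->
  exists s : {perm V}, s x = y /\ forall z, par (s z) = s (par z).
Proof.
move=> xy; have [D [f [isof xD fx Dx]]] := partial_iso_orbit xy.
have rD : r \in D.
  have [i <-] := par_reach x; have [Dpar _ _ _] := isof.
  by elim: i => //= i; apply: Dpar.
have [g [_ ginj gpar _] gf] := partial_iso_total isof rD.
have {}ginj : injective g by move=> u v; apply: ginj; rewrite inE.
exists (perm ginj); split=> [|z]; first by rewrite permE gf.
by rewrite !permE gpar ?inE.
Qed.

End Extension.

(** * Peeling the leaves of a tree *)

Section Peeling.
Variables (V : finType) (e : rel V).

Fixpoint peel k : {set V} :=
  if k is k'.+1 then [set x in peel k' | (1 < #|[set y in peel k' | e x y]|)%N] else setT.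

Definition peel_degree k x := #|[set y in peel k | e x y]|.

Lemma peelS k x : (x \in peel k.+1) = (x \in peel k) && (1 < peel_degree k x)%N.
Proof. by rewrite inE. Qed.

Lemma peel_antitone j k : (j <= k)%N -> peel k \subset peel j.
Proof.
move=> /subnK <-; elim: (k - j)%N => // n IH.
by apply: subset_trans IH; apply/subsetP=> x; rewrite addSn peelS => /andP[].
Qed.

Lemma peel_degree_le1 k x y z : (peel_degree k x <= 1)%N -> y \in peel k -> z \in peel k ->
  e x y -> e x z -> y = z.
Proof.
move=> /card_le1_eqP le1 yk zk xy xz.
by apply: le1; rewrite inE ?yk ?zk.
Qed.

Section Definable.
Variables (R : numFieldType) (K : (V -> V -> R) -> Prop) (KS : star_algebra K).
Hypothesis e_sym : symmetric e.
Hypothesis K_e : K (fun x y => (e x y)%:R).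
Hypothesis K_deg : diagonal K (fun x => (degree e x)%:R).

Lemma peel_degree_sum k x : (peel_degree k x)%:R = \sum_z (z \in peel k)%:R * (e x z)%:R :> R.
Proof.
rewrite /peel_degree -sum1_card natr_sum big_mkcond /=; apply: eq_bigr => z _.
by rewrite inE -natrM mulnb; case: ifP.
Qed.

(** The (x, y) entry of the product counts the paths x - z - y inside [peel k] with z
    a leaf of [peel k]; such a z has a single neighbour there, so x = y. *)
Lemma leaf_count_diagonal k (l := fun x => (x \in peel k) && (peel_degree k x == 1%N)) :
  diagonal K (fun x => (x \in peel k)%:R) -> diagonal K (fun x => (l x)%:R) ->
  diagonal K (fun x => (x \in peel k)%:R * \sum_z (e x z)%:R * (l z)%:R).
Proof.
move=> K_W K_l.
have := star_mul KS (star_mull KS K_W K_e) (star_mull KS K_l (star_mulr KS K_W K_e)).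
apply: star_ext => x y; rewrite /kmul /kdiag.
have [<-|xy] := eqVneq x y.
  rewrite mulr1n mulr_sumr; apply: eq_bigr => z _; rewrite [e z x]e_sym.
  by case: (x \in _); case: (e x z); case: (l z); rewrite ?(mulr0, mul0r, mulr1).
rewrite mulr0n big1 // => z _; rewrite -!natrM !mulnb.
case: (boolP (x \in _)) => // xk; case: (boolP (e x z)) => // xz.
case: (boolP (l z)) => // /andP[zk /eqP z1]; case: (boolP (e z y)) => // zy.
case: (boolP (y \in _)) => // yk; case/eqP: xy.
by apply: (@peel_degree_le1 k z); rewrite ?z1 // e_sym.
Qed.

(** Both properties have to be carried together: the leaves of [peel k] are a level
    set of the degrees inside it, and removing them lowers these degrees by the
    number of adjacent leaves. *)
Lemma peel_definable k : diagonal K (fun x => (x \in peel k)%:R) /\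
  diagonal K (fun x => ((x \in peel k) * peel_degree k x)%:R).
Proof.
elim: k => [|k [K_W K_h]].
  split; first by apply: diagonal_ext (diagonal_cst KS 1) => x; rewrite inE.
  apply: diagonal_ext K_deg => x; rewrite inE mul1n /peel_degree /degree.
  by congr (_%:R); apply: eq_card => y; rewrite !inE.
have K_W' : diagonal K (fun x => (x \in peel k.+1)%:R).
  have := diagonalB KS (diagonalB KS (diagonal_cst KS 1) (diagonal_level KS 0 K_h))
    (diagonal_level KS 1 K_h).
  apply: diagonal_ext => x; rewrite peelS -[0]/(0%:R) -[1 in X in _ - X]/(1%:R) !eqr_nat.
  case: (x \in _); last by rewrite mul0n /= subrr subr0.
  by rewrite mul1n /=; case: (peel_degree k x) => [|[|n]]; rewrite /= ?subr0 ?subrr.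
split=> //.
have K_l : diagonal K (fun x => ((x \in peel k) && (peel_degree k x == 1%N))%:R).
  apply: diagonal_ext (diagonal_level KS 1 K_h) => x; rewrite -[1 in LHS]/(1%:R) eqr_nat.
  by case: (x \in _); rewrite ?mul1n.
have := diagonalM KS K_W' (diagonalB KS K_h (leaf_count_diagonal K_W K_l)).
apply: diagonal_ext => x; rewrite natrM [in RHS]natrM.
have [xk'|] := boolP (x \in peel k.+1); last by rewrite !mul0r.
have xk : x \in peel k by move: xk'; rewrite peelS => /andP[].
(* A neighbour z of x in [peel k] has degree at least 1 there: it is a leaf or it
   survives in [peel k.+1]. *)
rewrite xk !mul1r !peel_degree_sum -sumrB; apply: eq_bigr => z _.
have [xz|_] := boolP (e x z); last by rewrite !mulr0 mul0r subrr.
rewrite !mulr1 mul1r peelS; have [zk|_] := boolP (z \in peel k); last by rewrite subrr.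
have : (0 < peel_degree k z)%N by apply/card_gt0P; exists x; rewrite inE xk e_sym.
by case: (peel_degree k z) => [|[|n]] //= _; rewrite ?subrr ?subr0.
Qed.

End Definable.

Hypothesis hT : is_tree e.

(** If every vertex of W had two neighbours in W, a simple path in W could be
    prolonged at its head by a neighbour other than the next vertex: that
    neighbour is new, since otherwise it would close a cycle.  So there would be
    simple paths of any length. *)
Lemma tree_min_degree (W : {set V}) x : x \in W ->
  exists2 y, y \in W & (#|[set z in W | e y z]| <= 1)%N.
Proof.
case: hT => _ e_sym e_irr _ acyc xW; apply: contrapT => noleaf.
have deg2 y : y \in W -> (1 < #|[set z in W | e y z]|)%N.
  by move=> yW; rewrite ltnNge; apply/negP=> ?; apply: noleaf; exists y.
have long n : exists y p, [/\ size p = n, path e y p, uniq (y :: p) & y \in W].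
  elim: n => [|n [y [p [sp ep up yW]]]]; first by exists x, [::].
  have [z [zW yz zh]] : exists z, [/\ z \in W, e y z & ohead p != Some z].
    have /card_gt1P[z1 [z2 [+ + z12]]] := deg2 y yW.
    rewrite !inE => /andP[z1W yz1] /andP[z2W yz2].
    have [h|h] := eqVneq (ohead p) (Some z1); last by exists z1.
    exists z2; split=> //; rewrite h; apply: contraNneq z12 => -[->] //.
  suff zp : z \notin y :: p.
    by exists z, (y :: p); split; rewrite /= ?sp ?zp // e_sym yz.
  apply/negP; rewrite inE => /orP[/eqP zy|zp]; first by rewrite zy e_irr in yz.
  case/splitPr: zp sp ep up zh => p1 p2 _ ep up zh.
  rewrite -cat_rcons in ep up.
  have : (size (rcons p1 z) <= 1)%N.
    apply: (acyc (y :: rcons p1 z)).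
    move: ep up; rewrite cat_path -cat_cons cat_uniq => /andP[ep _] /andP[up _].
    by apply/andP; split=> //; rewrite /= rcons_path ep last_rcons e_sym.
  by case: p1 zh {ep up} => [|u p1]; rewrite /= ?eqxx // size_rcons.
have [y [p [sp _ up _]]] := long #|V|.
by have := uniq_leq_size up (fun z _ => mem_enum V z); rewrite /= sp -cardE ltnn.
Qed.

(** Each round removes a vertex, so #|V| rounds exhaust the tree. *)
Lemma peel_card k : (#|peel k| <= #|V| - k)%N.
Proof.
elim: k => [|k IH]; first by rewrite subn0 max_card.
have [|[x xk]] := set_0Vmem (peel k).
  move=> k0; rewrite (_ : peel k.+1 = set0) ?cards0 //.
  by apply/eqP; rewrite -subset0 -k0 peel_antitone.
have [y yk y1] := tree_min_degree xk.
rewrite subnS -ltnS; case: (posnP (#|V| - k)%N) IH => [->|/prednK ->].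
  by rewrite leqn0 cards_eq0 => /eqP k0; rewrite k0 inE in xk.
apply: leq_trans; apply: proper_card; rewrite properE peel_antitone //.
by apply/subsetPn; exists y; rewrite // peelS yk /= -leqNgt.
Qed.

Definition rank x : nat := \max_(k < #|V| | x \in peel k) k.

Lemma rankP k x : (x \in peel k) = (k <= rank x)%N.
Proof.
have V0 : (0 < #|V|)%N by case: hT.
apply/idP/idP => [xk|].
  have kV : (k < #|V|)%N.
    rewrite ltnNge; apply/negP=> Vk; have := peel_card k.
    by rewrite (eqP Vk) leqn0 cards_eq0 => /eqP k0; rewrite k0 inE in xk.
  exact: (@leq_bigmax_cond _ (fun k : 'I__ => x \in peel k) val (Ordinal kV) xk).
pose A := [pred k : 'I_#|V| | x \in peel k].
have A0 : (0 < #|A|)%N by apply/card_gt0P; exists (Ordinal V0); rewrite !inE.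
have [j xj jE] := eq_bigmax_cond val A0.
by rewrite [rank x]jE => kj; apply: (subsetP (peel_antitone kj)).
Qed.

Lemma rank_ltn x : (rank x < #|V|)%N.
Proof.
have V0 : (0 < #|V|)%N by case: hT.
by rewrite -(prednK V0) ltnS; apply/bigmax_leqP => k _; rewrite -ltnS prednK.
Qed.

(** All neighbours of rank at least [rank x] lie in [peel (rank x)], where x has at
    most one neighbour, for it is not in the next layer. *)
Lemma higher_neighbour_unique x y z : e x y -> e x z ->
  (rank x <= rank y)%N -> (rank x <= rank z)%N -> y = z.
Proof.
move=> xy xz; rewrite -!rankP => yx zx; apply: peel_degree_le1 yx zx xy xz.
by have := rankP (rank x).+1 x; rewrite ltnn peelS rankP leqnn [(_ <= 1)%N]leqNgt /= => ->.
Qed.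

Definition parent x := odflt x [pick y | e x y && (rank x <= rank y)%N].

Lemma parent_eq x y : (parent x == y) =
  e x y && (rank x <= rank y)%N || (parent x == x) && (x == y).
Proof.
have [_ e_sym e_irr _ _] := hT.
rewrite /parent; case: pickP => /= [z /andP[xz rz]|none].
  have -> : (z == x) = false by apply/eqP=> zx; rewrite zx e_irr in xz.
  rewrite orbF; apply/eqP/andP => [<-//|[xy ry]].
  exact: higher_neighbour_unique xz xy rz ry.
by rewrite none eqxx.
Qed.

Lemma parent_fix x : (parent x == x) = (peel_degree (rank x) x == 0%N).
Proof.
have [_ e_sym e_irr _ _] := hT.
rewrite /parent cards_eq0 -subset0; case: pickP => /= [z /andP[xz rz]|none].
  have -> : (z == x) = false by apply/eqP=> zx; rewrite zx e_irr in xz.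
  by apply/esym/negbTE/subsetPn; exists z; rewrite inE // rankP rz.
rewrite eqxx; apply/esym/subsetP=> z; rewrite inE rankP andbC.
by rewrite none.
Qed.

Lemma parentP x : parent x != x -> e x (parent x) /\ (rank x <= rank (parent x))%N.
Proof.
move=> /negbTE px; have := parent_eq x (parent x).
by rewrite eqxx px orbF => /esym/andP[].
Qed.

(** Adjacency can be read off the parent map, because of two neighbours the one of
    larger rank is the parent of the other.  Hence a permutation that commutes
    with [parent] is an automorphism. *)
Lemma adjE x y : e x y = (x != y) && ((parent x == y) || (parent y == x)).
Proof.
have [_ e_sym e_irr _ _] := hT.
rewrite (parent_eq x) (parent_eq y) [y == x]eq_sym [e y x]e_sym.
case: (eqVneq x y) => [->|_]; first by rewrite e_irr.
by rewrite !andbF !orbF -andb_orr leq_total andbT.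
Qed.

Lemma rank_parent x : (rank x <= rank (parent x))%N.
Proof. by case: (eqVneq (parent x) x) => [->//|/parentP[]]. Qed.

Lemma parent_parent x : rank (parent x) = rank x -> parent (parent x) = x.
Proof.
case: (eqVneq (parent x) x) => [px _|/parentP[xp _] rx]; first by rewrite !px.
have [_ e_sym _ _ _] := hT.
by apply/eqP; rewrite parent_eq e_sym xp rx leqnn.
Qed.

(** A vertex of maximal rank and its parent form the centre of the tree.  By
    connectedness, following parents leads there from everywhere, and a vertex of
    maximal rank only meets vertices of maximal rank, where [parent] is an
    involution. *)
Lemma max_rank_root : exists r, [/\ parent (parent r) = r,
  forall x, exists i, iter i parent x = r &
  forall x, (x \in [set r; parent r]) = (rank x == rank r)].
Proof.
have [V0 e_sym e_irr conn _] := hT.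
have /card_gt0P[x0 _] := V0.
pose r := [arg max_(x > x0) rank x].
have r_max x : (rank x <= rank r)%N by rewrite /r; case: arg_maxnP => // i _; apply.
have rpr : rank (parent r) = rank r by apply/eqP; rewrite eqn_leq r_max rank_parent.
have ppr := parent_parent rpr.
have reach x : exists i, iter i parent x = r.
  have /connectP[p] := conn r x.
  elim/last_ind: p x => [|p y IH] x /=; first by move=> _ ->; exists 0.
  rewrite rcons_path last_rcons => /andP[ep ly] ->.
  have [i ir] := IH _ ep erefl.
  move: ly; rewrite adjE => /andP[_ /orP[]/eqP py]; last first.
    by exists i.+1; rewrite iterSr py.
  case: i ir => [|i]; last by rewrite iterSr py; exists i.
  by rewrite /= => lr; exists 1; rewrite /= -py lr.
exists r; split=> // x; apply/idP/eqP => [|rx].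
  by rewrite !inE => /orP[]/eqP->.
have [i] := reach x; elim: i x rx => [|i IH] x rx; first by move=> /= ->; rewrite !inE eqxx.
have rpx : rank (parent x) = rank x.
  by apply/eqP; rewrite eqn_leq rank_parent rx r_max.
rewrite iterSr => /(IH (parent x) (etrans rpx rx)); rewrite -{2}(parent_parent rpx) !inE.
by case/orP=> /eqP->; rewrite ?ppr eqxx ?orbT.
Qed.

Section DefinableParent.
Variables (R : numFieldType) (K : (V -> V -> R) -> Prop) (KS : star_algebra K).
Hypothesis K_e : K (fun x y => (e x y)%:R).
Hypothesis K_deg : diagonal K (fun x => (degree e x)%:R).

Let e_sym : symmetric e. Proof. by case: hT. Qed.

Lemma rank_definable k : diagonal K (fun x => (rank x == k)%:R).
Proof.
have W j := (peel_definable KS e_sym K_e K_deg j).1.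
apply: diagonal_ext (diagonalB KS (W k) (W k.+1)) => x.
by rewrite !rankP; case: (ltngtP k (rank x)); rewrite ?subrr ?subr0.
Qed.

(** The parent matrix is the sum over k of the adjacency matrix restricted to rows
    of rank k and columns in [peel k], plus the diagonal of the fixed vertices,
    which have degree 0 inside their last layer. *)
Lemma parent_definable : K (fun x y => (parent x == y)%:R).
Proof.
have [_ _ e_irr _ _] := hT.
have K_fix : diagonal K (fun x => (parent x == x)%:R).
  have : diagonal K (fun x => \sum_(k < #|V|) (rank x == k)%:R *
      (((x \in peel k) * peel_degree k x)%:R == 0 :> R)%:R).
    apply: diagonal_sum => // k _; apply: diagonalM => //; first exact: rank_definable.
    by apply: diagonal_level => //; case: (peel_definable KS e_sym K_e K_deg k).
  apply: diagonal_ext => x; rewrite (bigD1 (Ordinal (rank_ltn x))) //= eqxx mul1r.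
  rewrite rankP leqnn mul1n pnatr_eq0 -parent_fix big1 ?addr0 // => k kx.
  by rewrite [rank x == k]eq_sym -[(k : nat) == _]/(k == Ordinal (rank_ltn x)) (negbTE kx) mul0r.
have K_up : K (fun x y => \sum_(k < #|V|) (rank x == k)%:R * ((e x y)%:R * (y \in peel k)%:R)).
  apply: star_sum => // k; apply: star_mull => //; first exact: rank_definable.
  by apply: star_mulr => //; case: (peel_definable KS e_sym K_e K_deg k).
apply: star_ext (star_add KS K_up K_fix) => x y.
rewrite (bigD1 (Ordinal (rank_ltn x))) //= eqxx mul1r big1 => [|k kx]; last first.
  by rewrite [rank x == k]eq_sym -[(k : nat) == _]/(k == Ordinal (rank_ltn x)) (negbTE kx) mul0r.
rewrite addr0 rankP /kdiag -natrM mulnb -mulrnA -natrD [in RHS]parent_eq mulnb.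
case: (eqVneq x y) => [->|_]; first by rewrite e_irr add0n andbT.
by rewrite !andbF orbF addn0.
Qed.

End DefinableParent.
End Peeling.

(** * The algebra generated by adjacency and degrees *)

Section TreeAlgebra.
Variables (R : realType) (V : finType) (e : rel V).

Definition kernel_mx (F : V -> V -> R) : 'M[R]_#|V| :=
  \matrix_(i, j) F (enum_val i) (enum_val j).

Definition graph_kernel (F : V -> V -> R) : Prop :=
  gen_alg [:: 1%:M; adj_mx R e; deg_mx R e] (kernel_mx F).

Lemma kernel_mxM F G : kernel_mx (kmul F G) = kernel_mx F *m kernel_mx G.
Proof.
apply/matrixP=> i j; rewrite !mxE /kmul (reindex (@enum_val V V)) /=.
  by apply: eq_bigr => k _; rewrite !mxE.
by exists enum_rank => ? _; rewrite (enum_rankK, enum_valK).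
Qed.

Lemma gen_alg_trmx n (s : seq 'M[R]_n) M : {in s, forall X, X^T = X} ->
  gen_alg s M -> gen_alg s M^T.
Proof.
move=> sT; elim=> {M} [X Xs||a X _ IH|X Y _ IHX _ IHY|X Y _ IHX _ IHY].
- by rewrite sT //; apply: gen_alg_in.
- by rewrite trmx1; apply: gen_alg_1.
- by rewrite linearZ; apply: gen_alg_scale.
- by rewrite linearD; apply: gen_alg_add.
- by rewrite trmx_mul; apply: gen_alg_mul.
Qed.

Lemma kernel_adj : kernel_mx (fun x y => (e x y)%:R) = adj_mx R e.
Proof. by apply/matrixP=> i j; rewrite !mxE. Qed.

Lemma kernel_deg : kernel_mx (kdiag (fun x => (degree e x)%:R)) = deg_mx R e.
Proof. by apply/matrixP=> i j; rewrite !mxE /kdiag (inj_eq enum_val_inj). Qed.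

Lemma graph_kernel_star : symmetric e -> star_algebra graph_kernel.
Proof.
move=> e_sym; rewrite /graph_kernel; split.
- rewrite (_ : kernel_mx _ = 1%:M); first exact: gen_alg_1.
  by apply/matrixP=> i j; rewrite !mxE /kdiag (inj_eq enum_val_inj).
- move=> a F hF; rewrite (_ : kernel_mx _ = a *: kernel_mx F); first exact: gen_alg_scale.
  by apply/matrixP=> i j; rewrite !mxE.
- move=> F G hF hG; rewrite (_ : kernel_mx _ = kernel_mx F + kernel_mx G).
    exact: gen_alg_add.
  by apply/matrixP=> i j; rewrite !mxE.
- by move=> F G hF hG; rewrite kernel_mxM; apply: gen_alg_mul.
- move=> F hF; rewrite (_ : kernel_mx _ = (kernel_mx F)^T).
    apply: gen_alg_trmx hF => X; rewrite !inE => /or3P[]/eqP->.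
    + exact: trmx1.
    + by apply/matrixP=> i j; rewrite !mxE e_sym.
    + exact: tr_diag_mx.
  by apply/matrixP=> i j; rewrite !mxE.
Qed.

Lemma graph_kernel_adj : graph_kernel (fun x y => (e x y)%:R).
Proof. by rewrite /graph_kernel kernel_adj; apply: gen_alg_in; rewrite !inE eqxx orbT. Qed.

Lemma graph_kernel_deg : diagonal graph_kernel (fun x => (degree e x)%:R).
Proof.
by rewrite /diagonal /graph_kernel kernel_deg; apply: gen_alg_in; rewrite !inE eqxx !orbT.
Qed.

Lemma degree_aut s x : s \in graph_aut e -> degree e (s x) = degree e x.
Proof.
move=> /graph_autP hs; rewrite /degree -[RHS](card_imset _ (@perm_inj _ s)).
apply: eq_card => z; rewrite inE; apply/idP/imsetP => [hz|[w + ->]].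
  by exists ((s^-1)%g z); rewrite ?permKV // inE -hs permKV.
by rewrite inE hs.
Qed.

Lemma graph_kernel_aut F s x y : s \in graph_aut e -> graph_kernel F ->
  F (s x) (s y) = F x y.
Proof.
move=> hs; pose inv (M : 'M[R]_#|V|) := forall u v,
  M (enum_rank (s u)) (enum_rank (s v)) = M (enum_rank u) (enum_rank v).
suff H M : gen_alg [:: 1%:M; adj_mx R e; deg_mx R e] M -> inv M.
  by move/H => /(_ x y); rewrite !mxE !enum_rankK.
have inv1 : inv 1%:M.
  by move=> u v; rewrite !mxE !(inj_eq enum_rank_inj) (inj_eq perm_inj).
elim=> {M} [X||a X _ IH|X Y _ IHX _ IHY|X Y _ IHX _ IHY] //.
- rewrite !inE => /or3P[]/eqP-> // u v; rewrite !mxE !enum_rankK.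
    by rewrite (graph_autP _ _ hs).
  by rewrite !(inj_eq enum_rank_inj) (inj_eq perm_inj) degree_aut.
- by move=> u v; rewrite !mxE IH.
- by move=> u v; rewrite !mxE IHX IHY.
- move=> u v; rewrite !mxE (reindex enum_rank) /=; last first.
    by exists enum_val => ? _; rewrite (enum_rankK, enum_valK).
  rewrite [RHS](reindex enum_rank) /=; last first.
    by exists enum_val => ? _; rewrite (enum_rankK, enum_valK).
  by rewrite (reindex_inj (@perm_inj _ s)); apply: eq_bigr => w _; rewrite IHX IHY.
Qed.

(** The orbits are the path-similarity classes: the latter are contained in orbits by
    extension of partial isomorphisms, and they are unions of orbits because the
    elements of the algebra are invariant under automorphisms. *)
Lemma orbit_kernel x y : is_tree e -> graph_kernel
  (fun u v => (u \in orbit 'P (graph_aut e) x)%:R * (v \in orbit 'P (graph_aut e) y)%:R).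
Proof.
move=> hT; have [_ e_sym _ _ _] := hT.
have KS := graph_kernel_star e_sym.
have K_par := parent_definable hT KS graph_kernel_adj graph_kernel_deg.
have [r [par_root par_reach rootE]] := max_rank_root hT.
have K_root : diagonal graph_kernel (fun u => (u \in [set r; parent e r])%:R).
  apply: diagonal_ext (rank_definable hT KS graph_kernel_adj graph_kernel_deg (rank e r)) => u.
  by rewrite rootE.
pose sm := path_sim graph_kernel (parent e).
have sm_equiv : equivalence_rel sm := path_sim_equiv _ _.
have smE u w : sm u w = (u \in orbit 'P (graph_aut e) w).
  apply/idP/orbitP => [uw|[s hs <-]].
    have wu : sm w u by rewrite -((sm_equiv u w u).2 uw) (sm_equiv u u u).1.
    have sm_par a b : sm a b -> sm (parent e a) (parent e b).
      by rewrite /sm path_simE => /andP[].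
    have [s [sw s_par]] := similar_conjugate par_root par_reach sm_equiv sm_par
      (path_sim_root K_root) (path_sim_children KS K_par) wu.
    exists s => //; apply/graph_autP => a b.
    by rewrite !(adjE hT) !s_par !(inj_eq perm_inj).
  have s_par a : parent e (s a) = s (parent e a).
    have := graph_kernel_aut a (parent e a) hs K_par.
    by rewrite eqxx => /eqP; rewrite eqr_nat eqb1 => /eqP.
  apply/path_simP=> i; rewrite /= apermE.
  have -> : iter i (parent e) (s w) = s (iter i (parent e) w).
    by elim: i => //= i ->.
  apply/simP=> h /(graph_kernel_aut _ _ hs) H; move: (H (iter i (parent e) w) (iter i (parent e) w)).
  by rewrite /kdiag !eqxx.
apply: star_ext (class_kernel KS K_par par_root par_reach K_root x y) => u v.
by rewrite -!smE.
Qed.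

End TreeAlgebra.

(** X is the combination of matrix units with coefficients [X i j]; the kernel
    1_(O i) (x) 1_(O j) maps 1_(O j) to #|O j| 1_(O i), whence the
    normalisation. *)
Lemma quotient_realization (R : realType) (V : finType) (e : rel V) (m : nat)
    (O : 'I_m -> {set V}) (X : 'M[R]_m) : is_tree e -> orbit_listing e O ->
  exists2 M : 'M[R]_#|V|, gen_alg [:: 1%:M; adj_mx R e; deg_mx R e] M &
    M *m orbit_mx R O = orbit_mx R O *m X.
Proof.
move=> hT hO; have [_ e_sym _ _ _] := hT.
have Ox j : exists x, x \in O j.
  have: O j \in vertex_orbits e by case: hO => _ <-; apply: imset_f.
  by case/imsetP=> x _ ->; exists x; apply: orbit_refl.
have Odisj j k v : v \in O j -> v \in O k -> j = k.
  by case: (hO) => O_inj _ vj vk; apply: O_inj; rewrite (orbit_listingE hO vj) (orbit_listingE hO vk).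
pose F u v : R := \sum_i \sum_j X i j / #|O j|%:R * ((u \in O i)%:R * (v \in O j)%:R).
have KS := graph_kernel_star R e_sym.
have hF : graph_kernel e F.
  apply: star_sum => // i; apply: star_sum => // j; apply: star_scale => //.
  have [x xi] := Ox i; have [y yj] := Ox j.
  apply: star_ext (orbit_kernel R x y hT) => u v.
  by rewrite (orbit_listingE hO xi) (orbit_listingE hO yj).
exists (kernel_mx F) => //; apply/matrixP=> a k; rewrite !mxE.
rewrite (reindex (@enum_rank V)) /=; last first.
  by exists enum_val => ? _; rewrite (enum_rankK, enum_valK).
transitivity (\sum_i \sum_j \sum_v X i j / #|O j|%:R *
    ((enum_val a \in O i)%:R * (v \in O j)%:R) * (v \in O k)%:R).
  rewrite (eq_bigr (fun v => \sum_i \sum_j X i j / #|O j|%:R *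
    ((enum_val a \in O i)%:R * (v \in O j)%:R) * (v \in O k)%:R)); last first.
    move=> v _; rewrite !mxE !enum_rankK /F mulr_suml; apply: eq_bigr => i _.
    by rewrite mulr_suml.
  rewrite exchange_big; apply: eq_bigr => i _; exact: exchange_big.
apply: eq_bigr => i _; rewrite !mxE (bigD1 k) //= [X in _ + X]big1 ?addr0 => [|j jk].
  transitivity ((enum_val a \in O i)%:R * (X i k / #|O k|%:R) * \sum_v (v \in O k)%:R).
    rewrite mulr_sumr; apply: eq_bigr => v _.
    by case: (v \in O k); rewrite ?mulr0 // !mulr1 mulrC.
  rewrite (_ : \sum_v _ = #|O k|%:R) -?mulrA ?mulVf ?mulr1 //.
    by have [x xk] := Ox k; rewrite pnatr_eq0 -lt0n; apply/card_gt0P; exists x.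
  by rewrite -sum1_card natr_sum [RHS]big_mkcond; apply: eq_bigr => v _; case: ifP.
rewrite big1 // => v _; have [vj|] := boolP (v \in O j); last by rewrite !mulr0 mul0r.
by have [vk|] := boolP (v \in O k); rewrite ?mulr0 //; case/eqP: jk; apply: Odisj vj vk.
Qed.

(** The matrices M that leave the column space of S invariant act on coordinates,
    and this action is multiplicative. *)
Lemma gen_alg_quotient (R : realType) n m (S : 'M[R]_(n, m)) A B D E M :
  A *m S = S *m B -> D *m S = S *m E -> gen_alg [:: 1%:M; A; D] M ->
  exists2 Y, gen_alg [:: 1%:M; B; E] Y & M *m S = S *m Y.
Proof.
move=> hB hE; elim=> {M} [X||a X _ [Y hY eY]|X X' _ [Y hY eY] _ [Y' hY' eY']
                         |X X' _ [Y hY eY] _ [Y' hY' eY']].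
- rewrite !inE => /or3P[]/eqP->.
  + by exists 1%:M; [exact: gen_alg_1 | rewrite mul1mx mulmx1].
  + by exists B => //; apply: gen_alg_in; rewrite !inE eqxx orbT.
  + by exists E => //; apply: gen_alg_in; rewrite !inE eqxx !orbT.
- by exists 1%:M; [exact: gen_alg_1 | rewrite mul1mx mulmx1].
- by exists (a *: Y); [exact: gen_alg_scale | rewrite -scalemxAl eY scalemxAr].
- by exists (Y + Y'); [exact: gen_alg_add | rewrite mulmxDl mulmxDr eY eY'].
- by exists (Y *m Y'); [exact: gen_alg_mul | rewrite -mulmxA eY' mulmxA eY mulmxA].
Qed.

Lemma orbit_module_endo_mx (R : realType) (V : finType) (m : nat)
    (O : 'I_m -> {set V}) (f : 'End(subvs_of (orbit_module R O))) :
  exists X : 'M[R]_m, forall (u : subvs_of (orbit_module R O)) (w : 'cV[R]_m),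
    vsval u = orbit_mx R O *m w -> vsval (f u) = orbit_mx R O *m (X *m w).
Proof.
set S := orbit_mx R O; set U := orbit_module R O.
pose b j := vsproj U (S *m delta_mx j ord0).
have bE j : vsval (b j) = S *m delta_mx j ord0.
  by rewrite vsprojK //; apply/orbit_moduleP; exists (delta_mx j ord0).
have /fin_all_exists[c hc] j : exists w : 'cV[R]_m, vsval (f (b j)) = S *m w.
  by apply/orbit_moduleP; apply: subvsP.
exists (\matrix_(i, j) c j i ord0) => u w uw.
have -> : u = \sum_j w j ord0 *: b j.
  apply: val_inj; rewrite /= uw linear_sum /= [w in LHS]matrix_sum_delta mulmx_sumr.
  by apply: eq_bigr => j _; rewrite big_ord1 linearZ /= bE scalemxAr.
rewrite !linear_sum /= mulmxA; apply/colP=> i; rewrite summxE mxE; apply: eq_bigr => j _.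
rewrite !linearZ /= hc mxE mulrC; congr (_ * _).
by rewrite [LHS]mxE [RHS]mxE; apply: eq_bigr => k _; congr (_ * _); rewrite mxE.
Qed.

Theorem theorem4p1 (R : realType) (V : finType) (e : rel V) (hT : is_tree e)
    (m : nat) (O : 'I_m -> {set V}) (hO : orbit_listing e O)
    (B Delta : 'M[R]_m)
    (hB : adj_mx R e *m orbit_mx R O = orbit_mx R O *m B)
    (hDelta : deg_mx R e *m orbit_mx R O = orbit_mx R O *m Delta) :
  (forall X : 'M[R]_m, gen_alg [:: 1%:M; B; Delta] X) /\
  (forall f : 'End(subvs_of (orbit_module R O)),
     restricted_alg [:: 1%:M; adj_mx R e; deg_mx R e] f).
Proof.
split=> [X|f].
  have [M hM MS] := quotient_realization X hT hO.
  have [Y hY] := gen_alg_quotient hB hDelta hM.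
  by rewrite MS => /(orbit_mx_inj hO) ->.
have [X fX] := orbit_module_endo_mx f.
have [M hM MS] := quotient_realization X hT hO.
exists M => // u; have /orbit_moduleP[w uw] := subvsP u.
by rewrite (fX u w uw) uw !mulmxA MS.
Qed.
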